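(* Let $\mathbf{C}\subseteq\mathbb{R}^n$ be a nonempty closed convex set and let $F=(F_1,\dots,F_m):\mathbb{R}^n\to\mathbb{R}^m$ be differentiable with Jacobian satisfying $\|\nabla F(x)-\nabla F(y)\|\le L_F\|x-y\|$ for all $x,y\in\mathbf{C}$, where $L_F>0$. Let $f(x)=\|F(x)\|+I_{\mathbf{C}}(x)$ and assume that the problem $\min_{x\in\mathbb{R}^n} f(x)$ has a solution $x^*\in\mathbf{C}$. Let $(x_k)_{k\ge 0}$ be a sequence generated by the MPG-N algorithm with parameters $L_0,\delta>0$ and starting point $x_0\in\mathbf{C}$ (see context). Let $\mu>0$ with $\frac{1}{\mu}\in\left(0,\frac{1}{3L_F}\right)$ and set $y_{k+1}=\mathrm{prox}_{\mu f}(x_k)$ for $k\ge 0$. Then $$\min_{j=1,\dots,k}\mathrm{dist}\big(0,\partial f(y_j)\big)\le \mathcal{O}\left(\frac{1}{k^{1/2}}\right),$$ i.e., there is a constant $c>0$, independent of $k$, such that the left-hand side is at most $c\,k^{-1/2}$ for all $k\ge 1$. Moreover, any limit point $\bar{x}$ of the sequence $(x_k)_{k\ge 0}$ is a stationary point of the problem $\min_{x\in\mathbb{R}^n}f(x)$, i.e., $0\in\partial f(\bar{x})$.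
   Context: Notation. $\|\cdot\|$ is the Euclidean norm on vectors and the induced operator norm on matrices. $I_{\mathbf{C}}$ is the indicator function of $\mathbf{C}$ ($0$ on $\mathbf{C}$, $+\infty$ outside). $\nabla F(x)$ is the $m\times n$ Jacobian matrix. Proximal operator (convention used here): $\mathrm{prox}_{\mu f}(x)=\arg\min_{y} f(y)+\frac{\mu}{2}\|y-x\|^2$. (For $\mu>L_F$ it is single-valued for the function $f$ above.) Subdifferential: for a proper lower semicontinuous $f:\mathbb{R}^n\to\mathbb{R}\cup\{+\infty\}$ and $x\in\mathrm{dom}\,f$, the Fréchet subdifferential $\widehat{\partial}f(x)$ is the set of $g\in\mathbb{R}^n$ with $\liminf_{y\to x,\,y\ne x}\frac{f(y)-f(x)-\langle g,y-x\rangle}{\|y-x\|}\ge 0$, and $\widehat{\partial}f(x)=\emptyset$ if $x\notin\mathrm{dom}\,f$. The (limiting) subdifferential $\partial f(x)$ is the set of $g$ for which there exist $x^k\to x$ with $f(x^k)\to f(x)$ and $g^k\in\widehat{\partial}f(x^k)$ with $g^k\to g$. $\mathrm{dist}(0,\partial f(x))=\inf_{g\in\partial f(x)}\|g\|$ (equal to $+\infty$ if $\partial f(x)=\emptyset$). MPG-N algorithm. For $M>0$ and $x\in\mathbf{C}$, let $\Psi_M(y;x)=\|F(x)+\nabla F(x)(y-x)\|+\frac{M}{2}\|y-x\|^2$ and $T_M(x)=\arg\min_{y\in\mathbf{C}}\Psi_M(y;x)$ (unique by strong convexity). Given $x_0\in\mathbf{C}$ and $L_0,\delta>0$, a sequence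 $(x_k)_{k\ge0}$ is generated by MPG-N if for each $k\ge0$ there is $M_k$ with $L_0\le M_k\le 2L_F$ such that $$\frac{\delta}{2}\|T_{M_k}(x_k)-x_k\|^2\le \Psi_{M_k}\big(T_{M_k}(x_k);x_k\big)-f\big(T_{M_k}(x_k)\big),$$ and $x_{k+1}=T_{M_k}(x_k)$. *)

(* Defs.v *)
From HB Require Import structures.
From mathcomp Require Import all_boot all_order all_algebra.
From mathcomp Require Import all_classical all_reals all_analysis.

Set Implicit Arguments.
Unset Strict Implicit.
Unset Printing Implicit Defensive.

Import Order.TTheory GRing.Theory Num.Theory.
Import numFieldNormedType.Exports.

Local Open Scope classical_set_scope.
Local Open Scope ring_scope.

(* Vectors of R^n are row vectors.  The library norm `|x| on matrices is the
   sup norm, so the Euclidean norm is defined here; both induce the same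
   topology and the same notion of differentiability. *)

Definition dotp (R : realType) n (u v : 'rV[R]_n) : R :=
  \sum_(i < n) u 0 i * v 0 i.

Definition enorm (R : realType) n (v : 'rV[R]_n) : R := Num.sqrt (dotp v v).

(* Euclidean operator norm of the linear map v |-> v *m A.  As row vectors are
   acted upon from the right, [jacobian F x : 'M_(n, m)] is the transpose of the
   usual m x n matrix, and [v *m jacobian F x] is the directional derivative. *)
Definition opnorm (R : realType) n m (A : 'M[R]_(n, m)) : R :=
  sup [set enorm (v *m A) | v in [set v : 'rV[R]_n | enorm v <= 1]].

Definition indicator (R : realType) n (C : set 'rV[R]_n) (x : 'rV[R]_n) :
    \bar R :=
  if x \in C then 0%E else +oo%E.

Definition objective (R : realType) n m (F : 'rV[R]_n -> 'rV[R]_m)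
    (C : set 'rV[R]_n) (x : 'rV[R]_n) : \bar R :=
  ((enorm (F x))%:E + indicator C x)%E.

Definition argmin (R : realType) (T : Type) (D : set T) (g : T -> \bar R) :
    set T :=
  [set y | D y /\ forall z, D z -> (g y <= g z)%E].

Definition prox (R : realType) n (mu : R) (f : 'rV[R]_n -> \bar R)
    (x : 'rV[R]_n) : set 'rV[R]_n :=
  argmin setT (fun y => (f y + (mu / 2 * enorm (y - x) ^+ 2)%:E)%E).

Definition frechet_subdiff (R : realType) n (f : 'rV[R]_n -> \bar R)
    (x : 'rV[R]_n) : set 'rV[R]_n :=
  [set g | (f x < +oo)%E /\
    (0 <= limf_einf
       (fun y : 'rV[R]_n =>
          (f y - f x - (dotp g (y - x))%:E) * ((enorm (y - x))^-1)%:E)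
       x^')%E].

Definition subdiff (R : realType) n (f : 'rV[R]_n -> \bar R)
    (x : 'rV[R]_n) : set 'rV[R]_n :=
  [set g | (f x < +oo)%E /\
    exists (xs gs : nat -> 'rV[R]_n),
      [/\ xs k @[k --> \oo] --> x,
          f (xs k) @[k --> \oo] --> f x,
          (forall k, frechet_subdiff f (xs k) (gs k)) &
          gs k @[k --> \oo] --> g]].

(* ereal_inf set0 = +oo *)
Definition dist (R : realType) n (x : 'rV[R]_n) (A : set 'rV[R]_n) : \bar R :=
  ereal_inf [set (enorm (g - x))%:E | g in A].

Definition stationary (R : realType) n (f : 'rV[R]_n -> \bar R)
    (x : 'rV[R]_n) : Prop :=
  subdiff f x 0.

Definition Psi (R : realType) n m (F : 'rV[R]_n -> 'rV[R]_m) (M : R)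
    (y x : 'rV[R]_n) : R :=
  enorm (F x + (y - x) *m jacobian F x) + M / 2 * enorm (y - x) ^+ 2.

Definition prox_lin (R : realType) n m (F : 'rV[R]_n -> 'rV[R]_m)
    (C : set 'rV[R]_n) (M : R) (x : 'rV[R]_n) : set 'rV[R]_n :=
  argmin C (fun y => (Psi F M y x)%:E).

Definition mpgn_sequence (R : realType) n m (F : 'rV[R]_n -> 'rV[R]_m)
    (C : set 'rV[R]_n) (LF L0 delta : R) (x : nat -> 'rV[R]_n) : Prop :=
  C (x 0%N) /\
  forall k, exists M : R,
    [/\ L0 <= M <= 2 * LF,
        prox_lin F C M (x k) (x k.+1) &
        ((delta / 2 * enorm (x k.+1 - x k) ^+ 2)%:E
           <= (Psi F M (x k.+1) (x k))%:E - objective F C (x k.+1))%E].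

(* Main.v *)
(* With a = |x_{k+1} - x_k| and d = |y_{k+1} - x_k|, add the
   optimality of x_{k+1} for the linearized model, tested at y_{k+1}, to the
   optimality of y_{k+1} for the proximal problem, tested at x_{k+1}.  Model and
   objective differ by at most L/2 |z - x_k|^2 at z in C, so
   (mu - L - M) d^2 <= (mu + L - M) a^2, where M <= 2 L and mu > 3 L.  The
   sufficient decrease makes the sum of the a^2 finite, and mu (x_k - y_{k+1}) is
   a Frechet subgradient of the objective at y_{k+1}. *)
Require Import Defs.
From HB Require Import structures.
From mathcomp Require Import all_boot all_order all_algebra.
From mathcomp Require Import all_classical all_reals all_analysis.
From mathcomp Require Import ring lra.
Import Order.TTheory GRing.Theory Num.Theory.
Import numFieldNormedType.Exports.
Local Open Scope classical_set_scope.
Local Open Scope ring_scope.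

(** * Euclidean inner product and norm *)

Section euclidean.
Context {R : realType} {n : nat}.
Implicit Types u v w : 'rV[R]_n.

Lemma dotpC u v : dotp u v = dotp v u.
Proof. by apply: eq_bigr => i _; rewrite mulrC. Qed.

Lemma dotpDl u v w : dotp (u + v) w = dotp u w + dotp v w.
Proof. by rewrite -big_split; apply: eq_bigr => i _; rewrite mxE mulrDl. Qed.

Lemma dotpZl (a : R) u v : dotp (a *: u) v = a * dotp u v.
Proof. by rewrite mulr_sumr; apply: eq_bigr => i _; rewrite mxE mulrA. Qed.

Lemma dotpNl u v : dotp (- u) v = - dotp u v.
Proof. by rewrite -scaleN1r dotpZl mulN1r. Qed.

Lemma dotpBl u v w : dotp (u - v) w = dotp u w - dotp v w.
Proof. by rewrite dotpDl dotpNl. Qed.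

Lemma dotpDr u v w : dotp u (v + w) = dotp u v + dotp u w.
Proof. by rewrite dotpC dotpDl !(dotpC u). Qed.

Lemma dotpZr (a : R) u v : dotp u (a *: v) = a * dotp u v.
Proof. by rewrite dotpC dotpZl dotpC. Qed.

Lemma dotpNr u v : dotp u (- v) = - dotp u v.
Proof. by rewrite dotpC dotpNl dotpC. Qed.

Lemma dotp_ge0 u : 0 <= dotp u u.
Proof. by apply: sumr_ge0 => i _; rewrite -expr2 sqr_ge0. Qed.

Lemma enorm_ge0 u : 0 <= enorm u. Proof. exact: sqrtr_ge0. Qed.

Lemma sqr_enorm u : enorm u ^+ 2 = dotp u u.
Proof. by rewrite sqr_sqrtr// dotp_ge0. Qed.

Lemma coord_le_enorm u i : `|u 0 i| <= enorm u.
Proof.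
rewrite -ler_sqr ?nnegrE ?normr_ge0 ?enorm_ge0// sqr_enorm real_normK ?num_real//.
rewrite /dotp (bigD1 i)//= expr2 lerDl.
by apply: sumr_ge0 => j _; rewrite -expr2 sqr_ge0.
Qed.

Lemma norm_le_enorm u : `|u| <= enorm u.
Proof.
rewrite /Num.norm/= mx_normrE; apply: bigmax_le; first exact: enorm_ge0.
by move=> [i j] _ /=; rewrite ord1 coord_le_enorm.
Qed.

Lemma enorm_eq0 u : (enorm u == 0) = (u == 0).
Proof.
apply/eqP/eqP => [u0|->]; last first.
  by rewrite /enorm -(scale0r (0 : 'rV_n)) dotpZl mul0r sqrtr0.
by apply/eqP; rewrite -normr_le0 -u0 norm_le_enorm.
Qed.

Lemma enorm0 : enorm (0 : 'rV[R]_n) = 0.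
Proof. by apply/eqP; rewrite enorm_eq0. Qed.

Lemma enormZ (a : R) u : enorm (a *: u) = `|a| * enorm u.
Proof.
by rewrite /enorm dotpZl dotpZr mulrA -expr2 sqrtrM ?sqr_ge0// sqrtr_sqr.
Qed.

Lemma enormN u : enorm (- u) = enorm u.
Proof. by rewrite -scaleN1r enormZ normrN1 mul1r. Qed.

Lemma enormB u v : enorm (u - v) = enorm (v - u).
Proof. by rewrite -enormN opprB. Qed.

Lemma dotp_le_enorm u v : dotp u v <= enorm u * enorm v.
Proof.
have [->|v0] := eqVneq v 0.
  by rewrite enorm0 mulr0 -(scale0r (0 : 'rV_n)) dotpZr mul0r.
have A0 : 0 < dotp v v.
  by rewrite -sqr_enorm exprn_gt0// lt_neqAle eq_sym enorm_eq0 v0 enorm_ge0.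
suff uv : dotp u v ^+ 2 <= (enorm u * enorm v) ^+ 2.
  have [duv|/ltW duv] := leP 0 (dotp u v).
    by rewrite -ler_sqr ?nnegrE ?mulr_ge0 ?enorm_ge0.
  by rewrite (le_trans duv)// mulr_ge0 ?enorm_ge0.
rewrite exprMn !sqr_enorm.
(* This vector is [dotp v v] times the component of [u] orthogonal to [v]; its squared norm is
   [dotp v v] times the Cauchy-Schwarz gap. *)
have := dotp_ge0 (dotp v v *: u - dotp u v *: v).
rewrite dotpDl !dotpDr !(dotpNl, dotpNr) !(dotpZl, dotpZr) (dotpC v u) => h.
rewrite -(ler_pM2l A0) -subr_ge0 (le_trans h)// le_eqVlt.
by apply/orP; left; apply/eqP; ring.
Qed.

Lemma ler_enormD u v : enorm (u + v) <= enorm u + enorm v.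
Proof.
rewrite -ler_sqr ?nnegrE ?addr_ge0 ?enorm_ge0//.
rewrite sqr_enorm dotpDl !dotpDr (dotpC v u) sqrrD !sqr_enorm.
by have := dotp_le_enorm u v; lra.
Qed.

Lemma dotp_continuous v : continuous (fun u => dotp u v).
Proof.
apply: continuous_big => [|i _ u]; first exact: add_continuous.
by apply: (@cvgMr_tmp _ _ (nbhs u)); exact: (@coord_continuous R 1 n 0 i u).
Qed.

Lemma enorm_continuous : continuous (@enorm R n).
Proof.
move=> u; apply: (@continuous_comp _ _ _ (fun w => dotp w w) Num.sqrt).
  move: u; apply: continuous_big => [|i _ w]; first exact: add_continuous.
  by apply: (@cvgM _ _ (nbhs w)); exact: (@coord_continuous R 1 n 0 i w).
exact: sqrt_continuous.
Qed.

Lemma nbhs_enorm_lt {e : R} v : 0 < e -> \forall u \near v, enorm (u - v) < e.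
Proof.
move=> e0; have h : enorm (u - v) @[u --> v] --> (0 : R).
  rewrite -(enorm0) -(subrr v).
  apply: (@continuous_cvg _ _ _ (nbhs v) _ (fun u => u - v) (@enorm R n)).
    exact: enorm_continuous.
  by apply: (@cvgB _ _ _ (nbhs v)); [exact: cvg_id|exact: cvg_cst].
move/cvgr0Pnorm_lt : h => /(_ _ e0); apply: filterS => u.
by rewrite ger0_norm ?enorm_ge0.
Qed.

(** The topology comes from the sup norm, which [enorm] dominates, so Euclidean estimates suffice
    for convergence. *)
Lemma cvg_enorm0_cvg {T : Type} (G : set_system T) {FG : Filter G}
    (f : T -> 'rV[R]_n) u :
  (enorm (f t - u) @[t --> G] --> 0) -> f t @[t --> G] --> u.
Proof.
move=> h; apply/cvgrPdist_le => e e0.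
move/cvgr0Pnorm_le : h => /(_ e e0); apply: filterS => t.
rewrite ger0_norm ?enorm_ge0// distrC => h.
exact: le_trans (norm_le_enorm _) h.
Qed.

End euclidean.

(** * Euclidean operator norm *)

Section opnorm.
Context {R : realType} {n m : nat}.

(** Coordinates of a unit-ball vector are at most 1 in absolute value, so the sum of the row norms
    bounds every image. This makes [opnorm] a genuine upper bound. *)
Lemma opnorm_has_sup (A : 'M[R]_(n, m)) :
  has_sup [set enorm (v *m A) | v in [set v : 'rV[R]_n | enorm v <= 1]].
Proof.
split; first by exists (enorm (0 *m A)), 0 => //=; rewrite enorm0.
exists (\sum_(i < n) enorm (row i A)) => _ [v v1 <-].
rewrite mulmx_sum_row.
have : forall s : seq 'I_n, enorm (\sum_(i <- s) v 0 i *: row i A) <=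
   \sum_(i <- s) enorm (row i A); last exact.
elim=> [|i s ih]; first by rewrite !big_nil enorm0.
rewrite !big_cons; apply: (le_trans (ler_enormD _ _)); apply: lerD => //.
rewrite enormZ ler_piMl ?enorm_ge0//.
exact: le_trans (coord_le_enorm _ _) v1.
Qed.

Lemma enorm_mulmx_le (A : 'M[R]_(n, m)) v : enorm (v *m A) <= opnorm A * enorm v.
Proof.
have [->|v0] := eqVneq v 0; first by rewrite mul0mx !enorm0 mulr0.
have ev0 : 0 < enorm v by rewrite lt_neqAle eq_sym enorm_eq0 v0 enorm_ge0.
rewrite -ler_pdivrMr// mulrC -[_^-1]ger0_norm ?invr_ge0 ?enorm_ge0//.
rewrite -enormZ scalemxAl; apply: sup_upper_bound; first exact: opnorm_has_sup.
exists ((enorm v)^-1 *: v) => //=.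
by rewrite enormZ ger0_norm ?invr_ge0 ?enorm_ge0// mulVf ?gt_eqF.
Qed.

End opnorm.

(** * Derivatives along segments and the linearization error *)

Lemma is_derive_dotp {R : realType} {V : normedModType R} {m : nat}
    (G : V -> 'rV[R]_m) (t v : V) (dG e : 'rV[R]_m) :
  is_derive t v G dG -> is_derive t v (fun s => dotp (G s) e) (dotp dG e).
Proof.
move=> [dvG <-].
have h : (s^-1 *: (dotp (G (s *: v + t)) e - dotp (G t) e))@[s --> 0^'] -->
    dotp ('D_v G t) e.
  under eq_fun do rewrite -dotpBl -[_ *: dotp _ _]dotpZl.
  by apply: (continuous_cvg _ (dotp_continuous e _)); exact: dvG.
split; first by apply/cvg_ex; exists (dotp ('D_v G t) e).
exact/cvg_lim.
Qed.

(** The difference quotient in [s] regroups into that of [F] at [u + t *: h] in the direction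
    [h]. *)
Lemma is_derive_line {R : realType} {n m : nat} (F : 'rV[R]_n -> 'rV[R]_m)
    (u h : 'rV[R]_n) (t : R) : differentiable F (u + t *: h) ->
  is_derive t 1 (fun s : R => F (u + s *: h)) (h *m jacobian F (u + t *: h)).
Proof.
move=> dF.
have h1 : (s^-1 *: (F (u + (s *: 1 + t) *: h) - F (u + t *: h)))@[s --> 0^'] -->
    h *m jacobian F (u + t *: h).
  rewrite -deriveEjacobian//.
  under eq_fun => s.
    rewrite [s *: 1]mulr1 scalerDl addrCA; over.
  exact: (diff_derivable dF).
split; last exact/cvg_lim.
by apply/cvg_ex; exists (h *m jacobian F (u + t *: h)).
Qed.

Lemma convex_set_line {R : realType} {n : nat} {C : set 'rV[R]_n}
    (u v : 'rV[R]_n) (t : R) :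
  convex_set C -> C u -> C v -> 0 <= t <= 1 -> C (u + t *: (v - u)).
Proof.
move=> cC Cu Cv /andP[t0 t1].
have ti : Itv.spec (@Itv.num_sem _) (Itv.Real `[0%Z, 1%Z]) t.
  by rewrite /Itv.spec/= /Itv.num_sem/= num_real/= in_itv/= t0 t1.
have := cC v u (Itv.mk ti) (mem_set Cv) (mem_set Cu) => /set_mem.
rewrite /conv/=; congr C.
by rewrite scalerBl scale1r scalerBr addrCA addrA.
Qed.

(* The mean value theorem is applied to the component of t |-> F (u + t h) along
   the error vector e itself. *)
Lemma linearization_error {R : realType} {n m : nat} {C : set 'rV[R]_n}
    {F : 'rV[R]_n -> 'rV[R]_m} {L : R} (u v : 'rV[R]_n) :
    convex_set C -> (forall w, differentiable F w) ->
    (forall u v, C u -> C v ->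
       opnorm (jacobian F u - jacobian F v) <= L * enorm (u - v)) ->
    0 <= L -> C u -> C v ->
  enorm (F v - F u - (v - u) *m jacobian F u) <= L / 2 * enorm (v - u) ^+ 2.
Proof.
move=> cC dF lipF L0 Cu Cv.
set h := v - u; set e := F v - _ - _.
pose a := dotp (h *m jacobian F u) e.
pose b := L / 2 * enorm h ^+ 2 * enorm e.
(* The Lipschitz bound on the Jacobian makes the derivative of the first term exceed [a] by at most
   [2 * b * t]. Hence the derivative of [psi] is nonpositive on the segment, and psi 1 <= psi 0
   reads |e|^2 <= b, which is then divided by |e|. *)
pose psi (t : R) := dotp (F (u + t *: h)) e - (a * t + b * t ^+ 2).
have dpsi (t : R) : is_derive t 1 psi
    (dotp (h *m jacobian F (u + t *: h)) e - (a + 2 * b * t)).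
  have ? := is_derive_dotp _ _ _ _ e (is_derive_line F u h t (dF _)).
  apply: is_derive_eq.
  rewrite /GRing.scale/= !mulr1; ring.
have [|c /[!in_itv]/= /andP[c0 c1]] := @MVT R psi _ 0 1 ltr01 (fun t _ => dpsi t).
  by apply: derivable_within_continuous => t _; have [] := dpsi t.
rewrite /psi subr0 mulr1 scale1r scale0r addr0 (addrC u) subrK => psiE.
have [e0|e0] := eqVneq e 0; first by rewrite e0 enorm0 mulr_ge0 ?divr_ge0 ?sqr_ge0.
have le_c : dotp (h *m jacobian F (u + c *: h)) e - a <= 2 * b * c.
  rewrite -dotpBl -mulmxBr; apply: (le_trans (dotp_le_enorm _ _)).
  have Cc : C (u + c *: h) by apply: convex_set_line => //; rewrite !ltW.
  have uc : u + c *: h - u = c *: h by rewrite addrC addKr.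
  have := lipF _ _ Cc Cu; rewrite uc enormZ ger0_norm ?(ltW c0)// => J.
  have := le_trans (enorm_mulmx_le _ h) (ler_wpM2r (enorm_ge0 h) J) => H.
  by have := ler_wpM2r (enorm_ge0 e) H; rewrite /b; lra.
have ee : dotp (F v) e - dotp (F u) e - a = enorm e ^+ 2.
  by rewrite sqr_enorm -!dotpBl.
have ep : 0 < enorm e by rewrite lt_neqAle eq_sym enorm_eq0 e0 enorm_ge0.
by rewrite -(ler_pM2r ep) -expr2 -ee -/b; lra.
Qed.

(** * Subgradients at proximal points *)

Lemma prox_frechet_subdiff {R : realType} {n : nat} (mu : R) (f : 'rV[R]_n -> \bar R)
    (x p : 'rV[R]_n) : 0 < mu -> f p \is a fin_num -> prox mu f x p ->
  frechet_subdiff f p (mu *: (x - p)).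
Proof.
move=> mu0 /fineK fp [_ pmin]; split; first by rewrite -fp ltry.
rewrite limf_einfE; apply/lee_subgt0Pr => e e0; rewrite sub0e.
(* Minimality at [p] gives f z - f p >= <mu (x - p), z - p> - mu/2 |z - p|^2. After division by |z -
   p| the remainder is mu/2 |z - p|, at most [e] within this radius. *)
pose V := [set z : 'rV[R]_n | z != p /\ enorm (z - p) < 2 * e / mu].
apply: (@le_trans _ _ (ereal_inf
  [set ((f z - f p - (dotp (mu *: (x - p)) (z - p))%:E) * ((enorm (z - p))^-1)%:E)%E
     | z in V])); last first.
  apply: ereal_sup_ubound; exists V => //.
  have e2 : 0 < 2 * e / mu by rewrite divr_gt0// mulr_gt0.
  by rewrite /= /dnbhs /within/=; apply: filterS (nbhs_enorm_lt p e2) => z.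
apply: le_ereal_inf_tmp => _ [z [zp zpe] <-].
have d0 : 0 < enorm (z - p).
  by rewrite lt_neqAle eq_sym enorm_eq0 subr_eq0 zp enorm_ge0.
(* Minimality rules out f z = -oo; where f z = +oo the quotient is +oo. *)
have := pmin z Logic.I.
rewrite -fp; case: (f z) => [r| |]; last first.
- by rewrite addNye -EFinD leeNy_eq.
- by move=> _; rewrite !addye// gt0_mulye ?lte_fin ?invr_gt0// leey.
rewrite -!EFinD -EFinM !lee_fin.
rewrite ler_pdivlMr//.
have -> : enorm (z - x) ^+ 2 =
    enorm (z - p) ^+ 2 - 2 * dotp (x - p) (z - p) + enorm (p - x) ^+ 2.
  have -> : z - x = (z - p) - (x - p) by rewrite opprB addrA subrK.
  rewrite (enormB p); move: (z - p) (x - p) => u v.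
  rewrite !sqr_enorm dotpBl !dotpDr !dotpNr (dotpC v u); ring.
move=> h.
have h2 : mu * enorm (z - p) <= 2 * e by rewrite mulrC -ler_pdivlMr// ltW.
have := ler_wpM2r (ltW d0) h2.
by rewrite dotpZl; nra.
Qed.

Lemma frechet_sub_subdiff {R : realType} {n : nat} (f : 'rV[R]_n -> \bar R)
    (x : 'rV[R]_n) :
  frechet_subdiff f x `<=` subdiff f x.
Proof.
move=> g fg; split; first by case: fg.
by exists (fun=> x), (fun=> g); split => //; exact: cvg_cst.
Qed.

Lemma dist0_le {R : realType} {n : nat} (A : set 'rV[R]_n) (g : 'rV[R]_n) :
  A g -> (dist 0 A <= (enorm g)%:E)%E.
Proof. by move=> Ag; apply: ereal_inf_lbound; exists g; rewrite ?subr0. Qed.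

(** * Estimates for a single step *)

Section mpgn.
Context {R : realType} {n m : nat}.
Context {C : set 'rV[R]_n} {F : 'rV[R]_n -> 'rV[R]_m} {L mu : R}.
Hypothesis C_convex : convex_set C.
Hypothesis F_diff : forall u, differentiable F u.
Hypothesis F_lip : forall u v, C u -> C v ->
  opnorm (jacobian F u - jacobian F v) <= L * enorm (u - v).
Hypothesis L_gt0 : 0 < L.

Lemma objectiveE {z} : C z -> objective F C z = (enorm (F z))%:E.
Proof. by move=> Cz; rewrite /objective /indicator mem_set// adde0. Qed.

(** The feasible point [z] has a finite proximal value, so a minimizer cannot lie where the
    indicator is infinite. *)
Lemma prox_objective_mem {x p z} : C z -> prox mu (objective F C) x p -> C p.
Proof.
move=> Cz [_ /(_ z Logic.I)]; rewrite (objectiveE Cz).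
rewrite {1}/objective /indicator; case: ifPn => [/set_mem//|_].
by rewrite addey// addye// leye_eq.
Qed.

Lemma prox_dist_le {M : R} {x x1 p} : 0 <= M <= 2 * L -> 3 * L < mu -> C x ->
    prox_lin F C M x x1 -> prox mu (objective F C) x p ->
  (mu - 3 * L) * enorm (p - x) ^+ 2 <= (mu + L) * enorm (x1 - x) ^+ 2.
Proof.
move=> /andP[M0 M2] muL Cx [Cx1 x1min] pprox.
have Cp := prox_objective_mem Cx1 pprox.
have := x1min p Cp; rewrite lee_fin /Psi => h1.
have [_ /(_ x1 Logic.I)] := pprox; rewrite !objectiveE// -!EFinD lee_fin => h2.
have lin z : C z -> `|enorm (F z) - enorm (F x + (z - x) *m jacobian F x)| <=
    L / 2 * enorm (z - x) ^+ 2.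
  move=> Cz; apply: le_trans
    (linearization_error _ _ C_convex F_diff F_lip (ltW L_gt0) Cx Cz).
  set l := F x + _.
  have -> : F z - F x - (z - x) *m jacobian F x = F z - l by rewrite opprD addrA.
  rewrite ler_norml; apply/andP; split.
    by have := ler_enormD (l - F z) (F z); rewrite subrK enormB; lra.
  by have := ler_enormD (F z - l) l; rewrite subrK; lra.
have /ler_normlP[] := lin p Cp; have /ler_normlP[] := lin x1 Cx1.
set P := enorm (p - x) ^+ 2 in h1 h2 *; set Q := enorm (x1 - x) ^+ 2 in h1 h2 *.
have P0 : 0 <= P by exact: sqr_ge0.
have Q0 : 0 <= Q by exact: sqr_ge0.
(* [a] bounds objective minus model at [x1], and [b] bounds model minus objective at [p]. Then [M]
   is eliminated, using M <= 2 L on the left and M >= 0 on the right. *)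
move=> _ a b _.
have : (mu - L - M) * P <= (mu + L - M) * Q by lra.
have : 0 <= (2 * L - M) * P by rewrite mulr_ge0// subr_ge0.
have : 0 <= M * Q by rewrite mulr_ge0.
lra.
Qed.

(** The model at [x] itself has value [enorm (F x)], so its minimum is no larger; the acceptance
    test turns this into decrease of the objective. *)
Lemma prox_lin_descent {M delta : R} {x x1} : C x ->
    prox_lin F C M x x1 ->
    ((delta / 2 * enorm (x1 - x) ^+ 2)%:E
           <= (Psi F M x1 x)%:E - objective F C x1)%E ->
  delta / 2 * enorm (x1 - x) ^+ 2 <= enorm (F x) - enorm (F x1).
Proof.
move=> Cx [Cx1 /(_ x Cx)]; rewrite objectiveE// lee_fin -EFinB lee_fin => h1 h2.
apply: (le_trans h2); rewrite lerB// (le_trans h1)// /Psi.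
by rewrite subrr mul0mx addr0 enorm0 expr0n mulr0 addr0.
Qed.

End mpgn.

(** * Nonnegative sequences controlled by telescoping differences *)

Lemma sum_le_of_telescope {R : realType} (a f : nat -> R) (k : nat) :
    (forall j, 0 <= f j) -> (forall j, a j <= f j - f j.+1) ->
  \sum_(j < k) a j <= f 0%N.
Proof.
move=> f0 af; suff : \sum_(j < k) a j <= f 0%N - f k by have := f0 k; lra.
elim: k => [|k ih]; first by rewrite big_ord0 subrr.
by rewrite big_ord_recr/=; have := af k; lra.
Qed.

Lemma exists_le_average {R : realType} (a : nat -> R) (k : nat) (B : R) :
    (0 < k)%N ->
  \sum_(j < k) a j <= B -> exists2 j, (j < k)%N & a j <= B / k%:R.
Proof.
move=> k0 aB; apply: contrapT => h.
have : \sum_(j < k) B / k%:R < \sum_(j < k) a j.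
  apply: ltr_sum => [|j _]; first by apply/hasP; exists (Ordinal k0).
  by rewrite ltNge; apply/negP => aj; apply: h; exists j.
rewrite sumr_const card_ord -[X in X < _]mulr_natr divfK ?pnatr_eq0 -?lt0n//.
by rewrite ltNge aB.
Qed.

(** [f] is nonincreasing and bounded below, hence convergent; its consecutive differences tend to 0
    and squeeze [a]. *)
Lemma cvg0_of_telescope {R : realType} (a f : nat -> R) :
    (forall j, 0 <= f j) -> (forall j, 0 <= a j <= f j - f j.+1) ->
  a k @[k --> \oo] --> 0.
Proof.
move=> f0 af.
have fcvg : cvgn f.
  apply: nonincreasing_is_cvgn.
    by apply/nonincreasing_seqP => j; have /andP[] := af j; lra.
  by exists 0 => _ [j _ <-].
have df : f k - f k.+1 @[k --> \oo] --> 0.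
  by rewrite -(subrr (limn f)); apply: cvgB => //; rewrite cvg_shiftS.
by apply: (squeeze_cvgr _ (cvg_cst 0) df); exact: nearW.
Qed.

(** * Rate for the subgradient norms and stationarity of limit points *)

Theorem theorem1 (R : realType) (n m : nat)
    (C : set 'rV[R]_n) (F : 'rV[R]_n -> 'rV[R]_m)
    (LF L0 delta mu : R) (xstar : 'rV[R]_n) (x y : nat -> 'rV[R]_n)
    (C_nonempty : C !=set0)
    (C_closed : closed C)
    (C_convex : convex_set C)
    (F_diff : forall u : 'rV[R]_n, differentiable F u)
    (LF_gt0 : 0 < LF)
    (F_lip : forall u v : 'rV[R]_n, C u -> C v ->
       opnorm (jacobian F u - jacobian F v) <= LF * enorm (u - v))
    (xstar_C : C xstar)
    (xstar_min : argmin setT (objective F C) xstar)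
    (L0_gt0 : 0 < L0)
    (delta_gt0 : 0 < delta)
    (x_mpgn : mpgn_sequence F C LF L0 delta x)
    (mu_gt0 : 0 < mu)
    (mu_lt : 0 < mu^-1 < (3 * LF)^-1)
    (y_prox : forall k : nat, prox mu (objective F C) (x k) (y k.+1)) :
  (exists c : R, 0 < c /\
     forall k : nat, (1 <= k)%N ->
       (\big[mine/+oo]_(1 <= j < k.+1) dist 0 (subdiff (objective F C) (y j))
          <= (c / Num.sqrt k%:R)%:E)%E) /\
  (forall xbar : 'rV[R]_n,
     cluster (x k @[k --> \oo]) xbar -> stationary (objective F C) xbar).
Proof.
have muL : 3 * LF < mu.
  by case/andP: mu_lt => _; rewrite ltf_pV2 ?posrE ?mulr_gt0.
have [Cx0 step] := x_mpgn.
have Cx k : C (x k) by case: k => // k; have [M [_ []]] := step k.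
have Cy k : C (y k.+1) := prox_objective_mem (Cx 0%N) (y_prox k).
pose d k := enorm (y k.+1 - x k).
pose a k := delta / 2 * enorm (x k.+1 - x k) ^+ 2.
(* The first factor is the ratio from [prox_dist_le]; 2 / delta undoes the weight in [a]. Together
   they give d^2 <= K a. *)
pose K := (mu + LF) / (mu - 3 * LF) * (2 / delta).
have mu3 : 0 < mu - 3 * LF by rewrite subr_gt0.
have K0 : 0 <= K by apply: mulr_ge0; apply: divr_ge0; lra.
have a0 k : 0 <= a k by rewrite mulr_ge0 ?sqr_ge0// divr_ge0// ltW.
have descent k : a k <= enorm (F (x k)) - enorm (F (x k.+1)).
  by have [M [_ xk1 sufdec]] := step k; exact: prox_lin_descent xk1 sufdec.
have d2_le k : d k ^+ 2 <= K * a k.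
  have [M [/andP[LM M2] xk1 _]] := step k.
  have M02 : 0 <= M <= 2 * LF by rewrite M2 (le_trans (ltW L0_gt0) LM).
  have := prox_dist_le C_convex F_diff F_lip LF_gt0 M02 muL (Cx k) xk1 (y_prox k).
  rewrite mulrC -ler_pdivlMr// => /le_trans; apply.
  rewrite /K /a le_eqVlt; apply/orP; left; apply/eqP; field.
  by rewrite !gt_eqF.
have subdiff_y k : frechet_subdiff (objective F C) (y k.+1) (mu *: (x k - y k.+1)).
  by apply: prox_frechet_subdiff; rewrite ?objectiveE.
have enorm_g k : enorm (mu *: (x k - y k.+1)) = mu * d k.
  by rewrite enormZ (gtr0_norm mu_gt0) enormB.
split.
(* The summand 1 keeps the constant positive when F (x 0) = 0. *)
- exists (mu * Num.sqrt (K * enorm (F (x 0%N))) + 1); split.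
    by rewrite ltr_wpDl// mulr_ge0 ?sqrtr_ge0 ?ltW.
  move=> k k0.
  (* Some [a j] with j < k is at most the average |F (x 0)| / k; the point [y j.+1] then has index
     between 1 and [k]. *)
  have [j jk aj] := exists_le_average _ _ _ k0
    (sum_le_of_telescope a (fun k => enorm (F (x k))) k (fun _ => enorm_ge0 _) descent).
  rewrite big_add1/= big_mkord.
  apply: (le_trans (bigmin_le _ (Ordinal jk) _)) => /=.
  apply: (le_trans (dist0_le _ _ (frechet_sub_subdiff _ _ _ (subdiff_y j)))).
  rewrite lee_fin enorm_g.
  have k0' : 0 < Num.sqrt (k%:R : R) by rewrite sqrtr_gt0 ltr0n.
  rewrite ler_pdivlMr//.
  have KF0 : 0 <= K * enorm (F (x 0%N)) by rewrite mulr_ge0 ?enorm_ge0.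
  have : d j <= Num.sqrt (K * enorm (F (x 0%N))) / Num.sqrt k%:R.
    rewrite -[d j]ger0_norm ?enorm_ge0// -sqrtr_sqr -sqrtrV// -sqrtrM//.
    apply: ler_wsqrtr; apply: (le_trans (d2_le j)).
    by rewrite -[X in _ <= X]mulrA; exact: ler_wpM2l.
  by rewrite ler_pdivlMr// => /(ler_wpM2l (ltW mu_gt0)); lra.
move=> xbar xbar_cluster.
have d_cvg0 : d k @[k --> \oo] --> 0.
  have Ka : K * a k @[k --> \oo] --> 0.
    rewrite -(mulr0 K); apply: cvgMl_tmp.
    apply: (cvg0_of_telescope _ (fun k => enorm (F (x k)))) => k.
      exact: enorm_ge0.
    by rewrite a0 descent.
  have d2 : d k ^+ 2 @[k --> \oo] --> 0.
    apply: (squeeze_cvgr _ (cvg_cst 0) Ka); apply: nearW => k.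
    by rewrite sqr_ge0 d2_le.
  have -> : d = (fun k => Num.sqrt (d k ^+ 2)).
    by apply/funext => k; rewrite sqrtr_sqr ger0_norm ?enorm_ge0.
  by rewrite -[X in _ --> X]sqrtr0; exact: continuous_cvg (@sqrt_continuous R 0) d2.
(* [phi] need not be increasing: phi j >= j already makes it tend to infinity. *)
have /choice[phi phiP] : forall j, exists k,
    (j <= k)%N /\ enorm (x k - xbar) < harmonic j.
  move=> j.
  have [|_ [[k jk <-] xk]] := xbar_cluster [set x k | k in [set k | (j <= k)%N]] _ _
    (nbhs_enorm_lt xbar (harmonic_gt0 j)).
    by exists j => //= k jk; exists k.
  by exists k.
have phi_cvg : phi j @[j --> \oo] --> \oo.
  apply/cvgnyPge => A; exists A => //= j Aj.
  by have [jphi _] := phiP j; exact: leq_trans jphi.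
have dphi : d (phi j) @[j --> \oo] --> 0 := cvg_comp _ _ phi_cvg d_cvg0.
(* |y (phi j).+1 - xbar| is at most d (phi j) plus the distance from x (phi j) to [xbar], and both
   vanish. *)
have y_cvg : y (phi j).+1 @[j --> \oo] --> xbar.
  apply: cvg_enorm0_cvg.
  have dh : d (phi j) + harmonic j @[j --> \oo] --> 0.
    by rewrite -[X in _ --> X](addr0 0); apply: cvgD => //; exact: cvg_harmonic.
  apply: (squeeze_cvgr _ (cvg_cst 0) dh); apply: nearW => j.
  rewrite enorm_ge0/= -(subrKA (x (phi j))).
  apply: (le_trans (ler_enormD _ _)); rewrite lerD2l ltW//.
  by have [] := phiP j.
have Cxbar : C xbar.
  by apply: (closed_cvg _ C_closed _ _ y_cvg); exact: nearW.
split; first by rewrite objectiveE ?ltry.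
(* The subgradients have norm mu d (phi j), which tends to 0. All these points and [xbar] lie in
   [C], where the objective is the continuous function |F|, so the values converge too. *)
exists (fun j => y (phi j).+1), (fun j => mu *: (x (phi j) - y (phi j).+1)).
split.
- exact: y_cvg.
- rewrite objectiveE//.
  have -> : (fun j => objective F C (y (phi j).+1)) =
      (fun j => (enorm (F (y (phi j).+1)))%:E).
    by apply/funext => j; rewrite objectiveE.
  apply: cvg_EFin; first exact: nearW.
  apply: (continuous_cvg _ (enorm_continuous _)).
  by apply: (continuous_cvg _ _ y_cvg); exact: differentiable_continuous.
- by move=> j; exact: subdiff_y.
- apply: cvg_enorm0_cvg.
  under eq_fun do rewrite subr0 enorm_g.
  by rewrite -(mulr0 mu); exact: cvgMl_tmp.
Qed.
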